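(* Let $\mathcal{A}=\{A_1,\ldots,A_{11}\}\subset\mathbb{R}^{4\times 4}$, where $$A_1=\begin{pmatrix}-4&1&3&4\\-4&4&4&3\\4&-3&0&-3\\0&-4&2&1\end{pmatrix},\quad A_2=\begin{pmatrix}0&3&-1&-1\\0&-2&-1&2\\0&3&-2&3\\1&-1&-3&2\end{pmatrix},\quad A_3=\begin{pmatrix}-1&-4&-1&-1\\4&0&-1&1\\-2&0&0&2\\0&-1&2&2\end{pmatrix},$$ $$A_4=\begin{pmatrix}-2&-2&4&1\\-2&0&2&3\\1&-2&-4&3\\-3&3&4&-2\end{pmatrix},\quad A_5=\begin{pmatrix}4&2&-4&-4\\-4&-3&0&0\\1&-4&4&-2\\3&0&2&0\end{pmatrix},\quad A_6=\begin{pmatrix}2&2&3&4\\2&-4&3&1\\0&-2&1&-2\\-1&0&-1&-4\end{pmatrix},$$ $$A_7=\begin{pmatrix}2&1&4&0\\-1&-3&0&-1\\4&-1&-4&3\\0&3&0&4\end{pmatrix},\quad A_8=\begin{pmatrix}0&3&-1&2\\4&2&1&1\\-2&-1&3&4\\3&0&3&3\end{pmatrix},\quad A_9=\begin{pmatrix}2&-1&4&-4\\-2&2&3&-1\\-1&1&4&-1\\-3&-4&4&3\end{pmatrix},$$ $$A_{10}=\begin{pmatrix}-4&2&0&-1\\4&1&0&4\\-1&-3&4&1\\-3&2&4&-4\end{pmatrix},\quad A_{11}=\begin{pmatrix}1&1&-2&0\\3&0&-2&-4\\2&-4&-2&4\\4&3&2&-2\end{pmatrix}.$$ Then the map $\mathbf{M}_{\mathcal{A}}:\mathbb{R}^{4\times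 4}\to\mathbb{R}^{11}$, $\mathbf{M}_{\mathcal{A}}(Q)=[\langle A_1,Q\rangle,\ldots,\langle A_{11},Q\rangle]$, is injective on $\mathcal{L}_1^{\mathbb{R}}\subset\mathbb{R}^{4\times 4}$.
   Context: For $A,Q\in\mathbb{R}^{4\times 4}$, $\langle A,Q\rangle:=\mathrm{trace}(A^{\top}Q)$. $\mathcal{L}_1^{\mathbb{R}}:=\{X\in\mathbb{R}^{4\times 4}:\mathrm{rank}(X)\leq 1\}$. *)

(* Defs.v *)
From mathcomp Require Import all_boot all_order all_algebra.
From mathcomp Require Import reals.

Set Implicit Arguments.
Unset Strict Implicit.
Unset Printing Implicit Defensive.

Import GRing.Theory Num.Theory.
Local Open Scope ring_scope.

Definition inner_mx (R : realType) (n : nat) (A Q : 'M[R]_n) : R :=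
  \tr (A^T *m Q).

Definition measure_map (R : realType) (n m : nat) (A : m.-tuple 'M[R]_n)
    (Q : 'M[R]_n) : 'rV[R]_m :=
  \row_(i < m) inner_mx (tnth A i) Q.

Definition rank_le1 (R : realType) (n : nat) : {pred 'M[R]_n} :=
  [pred X | (\rank X <= 1)%N].

Definition mx_of_rows (R : realType) (n : nat) (rows : seq (seq int)) :
    'M[R]_n :=
  \matrix_(i < n, j < n) ((nth [::] rows i)`_j)%:~R.

Arguments rank_le1 R n : clear implicits.

Definition A1 (R : realType) : 'M[R]_4 := mx_of_rows R 4
  [:: [:: -4;  1;  3;  4];
      [:: -4;  4;  4;  3];
      [::  4; -3;  0; -3];
      [::  0; -4;  2;  1]].

Definition A2 (R : realType) : 'M[R]_4 := mx_of_rows R 4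
  [:: [::  0;  3; -1; -1];
      [::  0; -2; -1;  2];
      [::  0;  3; -2;  3];
      [::  1; -1; -3;  2]].

Definition A3 (R : realType) : 'M[R]_4 := mx_of_rows R 4
  [:: [:: -1; -4; -1; -1];
      [::  4;  0; -1;  1];
      [:: -2;  0;  0;  2];
      [::  0; -1;  2;  2]].

Definition A4 (R : realType) : 'M[R]_4 := mx_of_rows R 4
  [:: [:: -2; -2;  4;  1];
      [:: -2;  0;  2;  3];
      [::  1; -2; -4;  3];
      [:: -3;  3;  4; -2]].

Definition A5 (R : realType) : 'M[R]_4 := mx_of_rows R 4
  [:: [::  4;  2; -4; -4];
      [:: -4; -3;  0;  0];
      [::  1; -4;  4; -2];
      [::  3;  0;  2;  0]].

Definition A6 (R : realType) : 'M[R]_4 := mx_of_rows R 4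
  [:: [::  2;  2;  3;  4];
      [::  2; -4;  3;  1];
      [::  0; -2;  1; -2];
      [:: -1;  0; -1; -4]].

Definition A7 (R : realType) : 'M[R]_4 := mx_of_rows R 4
  [:: [::  2;  1;  4;  0];
      [:: -1; -3;  0; -1];
      [::  4; -1; -4;  3];
      [::  0;  3;  0;  4]].

Definition A8 (R : realType) : 'M[R]_4 := mx_of_rows R 4
  [:: [::  0;  3; -1;  2];
      [::  4;  2;  1;  1];
      [:: -2; -1;  3;  4];
      [::  3;  0;  3;  3]].

Definition A9 (R : realType) : 'M[R]_4 := mx_of_rows R 4
  [:: [::  2; -1;  4; -4];
      [:: -2;  2;  3; -1];
      [:: -1;  1;  4; -1];
      [:: -3; -4;  4;  3]].

Definition A10 (R : realType) : 'M[R]_4 := mx_of_rows R 4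
  [:: [:: -4;  2;  0; -1];
      [::  4;  1;  0;  4];
      [:: -1; -3;  4;  1];
      [:: -3;  2;  4; -4]].

Definition A11 (R : realType) : 'M[R]_4 := mx_of_rows R 4
  [:: [::  1;  1; -2;  0];
      [::  3;  0; -2; -4];
      [::  2; -4; -2;  4];
      [::  4;  3;  2; -2]].

Definition calA (R : realType) : 11.-tuple 'M[R]_4 :=
  [tuple A1 R; A2 R; A3 R; A4 R; A5 R; A6 R; A7 R; A8 R; A9 R; A10 R; A11 R].

(* Main.v *)
Require Import Defs.
From Stdlib Require Import ZArith.
From mathcomp Require Import all_boot all_order all_algebra.
From mathcomp Require Import ssrZ ring lra.
From mathcomp Require Import reals.

(** A difference of two matrices of rank at most 1 has rank at most 2, so it
    suffices that the 5-dimensional kernel of the measurement map contains no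
    nonzero real matrix of rank at most 2. Parametrize the kernel by a pencil
    M(x), with x in R^5. That the 3 x 3 minors of M(x) have no common real zero
    but 0 is witnessed in degree 4: some combination of these minors with linear
    coefficients in x equals a sum of squares of quadratic forms in x that is
    positive for x <> 0. *)

Import Order.TTheory GRing.Theory Num.Theory.

Local Open Scope ring_scope.

Delimit Scope Z_scope with bigZ.

(* Binary integers, because numerals in [nat] and [int] are unary. *)
Definition zr (R : pzRingType) (c : Z) : R := (int_of_Z c)%:~R.
Arguments zr R c : simpl never.

Lemma zr_gt0 (R : numDomainType) (c : Z) : (0 <? c)%bigZ -> 0 < zr R c.
Proof.
case: c => [//|p _|//]; rewrite /zr ltr0z /=.
by have := Pos2Nat.is_pos p; case: (Pos.to_nat p) => // /Nat.lt_irrefl.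
Qed.

Lemma zr_ge0 (R : numDomainType) (c : Z) : (0 <=? c)%bigZ -> 0 <= zr R c.
Proof.
by case: c => [_|p _|//]; [rewrite /zr mulr0z | exact/ltW/zr_gt0].
Qed.

Section QuadraticForms.
Variable R : realDomainType.

Fixpoint dotZ (c : seq Z) (z : seq R) : R :=
  if (c, z) is (a :: c', y :: z') then zr R a * y + dotZ c' z' else 0.

(* [rows] is an upper triangular matrix stored without its zeros: the k-th row
   starts at column k. *)
Fixpoint triangular_squares (rows : seq (seq Z)) (z : seq R) : R :=
  if rows is r :: rows' then dotZ r z ^+ 2 + triangular_squares rows' (behead z)
  else 0.

Fixpoint binomial_squares (e : seq (nat * nat * Z)) (z : seq R) : R :=
  if e is (i, j, c) :: e' then
    zr R (Z.abs c) * (z`_i + zr R (Z.sgn c) * z`_j) ^+ 2 + binomial_squares e' z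
  else 0.

Lemma triangular_squares_ge0 rows z : 0 <= triangular_squares rows z.
Proof.
by elim: rows z => //= r rows IH z; rewrite addr_ge0 ?sqr_ge0.
Qed.

Lemma binomial_squares_ge0 e z : 0 <= binomial_squares e z.
Proof.
elim: e => //= -[[i j] c] e IH; apply: addr_ge0 => //.
by apply: mulr_ge0 (sqr_ge0 _); apply/zr_ge0/Z.leb_le/Z.abs_nonneg.
Qed.

Lemma dotZ_sqr_ge0 b z :
  all (Z.ltb 0) b -> 0 <= dotZ b [seq y ^+ 2 | y <- z].
Proof.
elim: b z => [|c b IH] [|y z] //= /andP[c_gt0 b_gt0].
by rewrite addr_ge0 ?IH // mulr_ge0 ?sqr_ge0 // ltW ?zr_gt0.
Qed.

(** Equal sizes matter because [dotZ] stops at the end of the shorter list and would leave further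
    entries of [z] unconstrained. *)
Lemma dotZ_sqr_le0 b z :
  all (Z.ltb 0) b -> size b = size z ->
  dotZ b [seq y ^+ 2 | y <- z] <= 0 -> all (pred1 0) z.
Proof.
elim: b z => [|c b IH] [|y z] //= /andP[c_gt0 b_gt0] [eq_sz] le0.
have tail_ge0 := dotZ_sqr_ge0 b z b_gt0.
have head_ge0 : 0 <= zr R c * y ^+ 2.
  by rewrite mulr_ge0 ?sqr_ge0 // ltW ?zr_gt0.
apply/andP; split; last by apply: IH => //; lra.
have /eqP : zr R c * y ^+ 2 = 0 by lra.
by rewrite mulf_eq0 sqrf_eq0 gt_eqF ?zr_gt0.
Qed.

End QuadraticForms.

Section Minors.
Variable R : comPzRingType.
Implicit Type f : nat -> nat -> R.

Definition det3 f : R :=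
  f 0%N 0%N * (f 1%N 1%N * f 2%N 2%N - f 1%N 2%N * f 2%N 1%N)
  - f 0%N 1%N * (f 1%N 0%N * f 2%N 2%N - f 1%N 2%N * f 2%N 0%N)
  + f 0%N 2%N * (f 1%N 0%N * f 2%N 1%N - f 1%N 1%N * f 2%N 0%N).

Definition minor f (i j : nat) : R := det3 (fun a b => f (bump i a) (bump j b)).

(** Each 3 x 3 submatrix is a product of a 3 x 2 and a 2 x 3 matrix, so its determinant is
    identically zero. *)
Lemma minor_rank2 (a b c d : nat -> R) f i j :
  (forall k l, f k l = a k * b l - c k * d l) -> minor f i j = 0.
Proof. by move=> fE; rewrite /minor /det3 !fE; ring. Qed.

End Minors.

(* An LLL-reduced basis of the lattice of integer matrices, flattened by rows,
   in the kernel of the measurement map. *)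
Definition kernel_basis : seq (seq Z) :=
  [:: [:: -4; -22; -19; -3; 0; 2; 41; -5; 27; 3; 25; 28; -9; 10; -27; -3];
      [:: 46; -1; 3; -23; 29; 42; 11; 41; 19; 9; -22; -24; 15; 14; -4; -8];
      [:: 59; -2; -18; 39; -1; 21; -55; 25; 38; 14; 7; 13; -39; -22; 22; -10];
      [:: 25; -36; 19; 10; 3; 7; -18; 34; 68; 63; 46; 15; 41; 10; 14; -33];
      [:: 6; 19; -66; 25; 19; -23; 27; -18; 45; 59; -23; -24; -40; 0; 68; 6]]%bigZ.

Definition pencil (R : realDomainType) (x : seq R) (i j : nat) : R :=
  dotZ R [seq nth 0%bigZ k (4 * i + j)%N | k <- kernel_basis] x.

(* Coefficients of a left inverse of [x |-> pencil x]. *)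
Definition kernel_coordinates : seq (seq Z) :=
  [:: [:: 3; 4; -2; -2; -3; 1; 0; -2; -2; 3; 1; 2; 2; 0; -1; 0];
      [:: -3; 0; -3; 0; -1; 4; -1; 0; 0; -1; 1; -1; 1; 0; 1; -2];
      [:: -3; 2; 0; 1; -1; 3; -2; -1; 1; 1; -3; 2; -1; 5; -1; -3];
      [:: 3; 0; 1; 0; -1; 1; 0; -5; -1; 1; 2; -3; -1; 2; -1; -2];
      [:: 0; -2; -1; 0; 0; 4; 0; -4; -1; 1; 1; -2; 1; -3; 0; -1]]%bigZ.

Definition flatten4 (R : Type) (f : nat -> nat -> R) : seq R :=
  [seq f i j | i <- iota 0 4, j <- iota 0 4].

Definition coordinates (R : realDomainType) (f : nat -> nat -> R) : seq R :=
  [seq dotZ R p (flatten4 R f) | p <- kernel_coordinates].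

(* The certificate comes from a positive definite 15 x 15 Gram matrix found by
   semidefinite programming, indexed by the quadratic monomials z_i in x.
   [gram_factor] is a rounded Cholesky factor of it; an entry [(i, j, e)] of
   [rounding_error] is an error term [2 e z_i z_j], here completed to a
   square at the expense of the coefficients of z_i^2 and z_j^2;
   [diagonal_slack] is what remains of the diagonal. *)
Definition minor_multipliers : seq (seq (seq Z)) :=
  [:: [:: [:: 7; 4; -1; -1; 6];
          [:: -6; 0; -2; 3; 2];
          [:: -6; 5; 3; -3; 2];
          [:: -1; 4; -2; 0; 5]];
      [:: [:: -3; -6; 4; 2; 1];
          [:: 4; 0; -1; 2; -3];
          [:: 1; 5; 0; 0; 4];
          [:: -3; -2; 0; 0; -4]];
      [:: [:: 6; 1; -9; -1; 2];
          [:: -5; -3; -2; 5; -4];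
          [:: 0; -2; 4; 1; -4];
          [:: -3; -6; -8; 5; -2]];
      [:: [:: 2; 4; -3; -1; 0];
          [:: -5; 6; 0; -3; 2];
          [:: -4; -1; -5; -3; -1];
          [:: -3; 4; -2; -1; 4]]]%bigZ.

Definition gram_factor : seq (seq Z) :=
  [:: [:: 41; -2; -12; -5; 13; -3; 8; -9; -2; -29; -1; -8; -10; 9; 7];
      [:: 91; 9; -3; 4; -1; -9; 15; 0; -3; 7; 5; -8; 8; 4];
      [:: 73; 6; -14; 7; -1; 0; 5; -29; 11; -9; 2; 1; 1];
      [:: 82; 23; 1; 5; -13; 3; 4; -25; -2; 2; -10; 0];
      [:: 99; 6; 11; 0; 4; -14; 9; -31; -4; 12; 4];
      [:: 61; 4; 5; -13; -23; -17; 16; -10; 5; -10];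
      [:: 79; 1; 6; 1; 21; 13; 6; 6; -7];
      [:: 85; 5; 16; -3; 5; -5; 8; -5];
      [:: 81; 14; 8; 1; 5; 7; -18];
      [:: 64; 5; -4; -25; 14; -23];
      [:: 72; 6; 25; -14; -2];
      [:: 70; 2; 23; -20];
      [:: 49; -4; -31];
      [:: 61; 2];
      [:: 37]]%bigZ.

Definition rounding_error : seq (nat * nat * Z) :=
  [:: (0%N, 1%N, -3710); (0%N, 2%N, -236); (0%N, 3%N, 1150); (0%N, 4%N, -7);
      (0%N, 6%N, -2880); (0%N, 8%N, -4039); (0%N, 11%N, 12315);
      (0%N, 13%N, -8818); (1%N, 3%N, 11360); (1%N, 5%N, 1758);
      (1%N, 7%N, 15245); (1%N, 9%N, 4526); (1%N, 10%N, -19238);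
      (1%N, 12%N, -3929); (2%N, 3%N, -4475); (2%N, 5%N, -5252);
      (2%N, 9%N, 11938); (2%N, 10%N, 1027); (2%N, 11%N, -10582);
      (2%N, 12%N, 11343); (2%N, 13%N, 3907); (3%N, 8%N, -12347);
      (3%N, 12%N, -10474); (4%N, 5%N, -6918); (4%N, 6%N, 13133);
      (4%N, 8%N, 8306); (4%N, 11%N, 11002); (4%N, 12%N, 1987);
      (4%N, 13%N, -3397); (4%N, 14%N, 10763); (5%N, 6%N, -771);
      (5%N, 7%N, -5542); (5%N, 8%N, -2028); (5%N, 13%N, 336);
      (6%N, 7%N, 12294); (6%N, 8%N, -10240); (6%N, 9%N, -563);
      (6%N, 10%N, 11395); (6%N, 12%N, -7851); (6%N, 13%N, -4301);
      (6%N, 14%N, -2400); (7%N, 12%N, 4199); (8%N, 9%N, -10726);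
      (8%N, 12%N, 3992); (8%N, 13%N, -4541); (8%N, 14%N, 9245);
      (9%N, 10%N, 2207); (9%N, 11%N, 7166); (9%N, 13%N, 728);
      (10%N, 12%N, -6286); (10%N, 13%N, -6898); (11%N, 13%N, 10321);
      (11%N, 14%N, 385); (12%N, 13%N, 1087); (13%N, 14%N, -3474)]%bigZ.

Definition diagonal_slack : seq Z :=
  [:: 55675; 26338; 25488; 21522; 30281; 54339; 36622; 30800; 41742; 30642;
      21419; 27633; 46448; 30840; 59185]%bigZ.

Definition quadratic_monomials (R : pzRingType) (x : seq R) : seq R :=
  [seq x`_i * x`_j | i <- iota 0 5, j <- iota i (5 - i)%N].

(** Both sides are quartic forms in x. The factor 2 makes all coefficients even, so that the Gram
    matrix can have integer off-diagonal entries. *)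
Lemma sos_certificate (R : realDomainType) (x0 x1 x2 x3 x4 : R) :
  let x := [:: x0; x1; x2; x3; x4] in
  let z := quadratic_monomials R x in
  2 * (\sum_(i < 4) \sum_(j < 4)
         dotZ R (nth [::] (nth [::] minor_multipliers i) j) x
         * minor R (pencil R x) i j)
  = zr R 268%bigZ * triangular_squares R gram_factor z
    + binomial_squares R rounding_error z
    + dotZ R diagonal_slack [seq y ^+ 2 | y <- z].
Proof.
by rewrite /= !big_ord_recr !big_ord0 /= /minor /det3 /pencil /= /zr; ring.
Qed.

Lemma eq0_of_minors_eq0 (R : realDomainType) (x : seq R) :
  size x = 5%N ->
  (forall i j, (i < 4)%N -> (j < 4)%N -> minor R (pencil R x) i j = 0) ->
  x = nseq 5 0.
Proof.
case: x => [|x0 [|x1 [|x2 [|x3 [|x4 []]]]]] // _ minors0.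
have := sos_certificate R x0 x1 x2 x3 x4; cbv zeta.
rewrite big1 => [|i _]; last first.
  by rewrite big1 // => j _; rewrite minors0 ?mulr0.
rewrite mulr0 => /esym sos0.
have w_ge0 : 0 <= zr R 268%bigZ by apply: zr_ge0.
have := mulr_ge0 w_ge0 (triangular_squares_ge0 R gram_factor
  (quadratic_monomials R [:: x0; x1; x2; x3; x4])).
have := binomial_squares_ge0 R rounding_error
  (quadratic_monomials R [:: x0; x1; x2; x3; x4]).
move=> bin_ge0 tri_ge0.
have : all (pred1 0) (quadratic_monomials R [:: x0; x1; x2; x3; x4]).
  by apply: (dotZ_sqr_le0 R diagonal_slack) => //; lra.
(* Among the fifteen vanishing monomials are the five squares, which [orbb] reduces to x_i = 0. *)
rewrite /= !mulf_eq0 !orbb; do 15?[case/andP => /eqP ?].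
by subst.
Qed.

Lemma rank_le1_outer (F : fieldType) (m n : nat) (X : 'M[F]_(m, n)) :
  (\rank X <= 1)%N -> exists u v, forall i j, X i j = u i * v j.
Proof.
have := mulmx_base X; move: (col_base X) (row_base X).
case: (\rank X) => [|[|//]] B C <- _.
  by exists (fun=> 0), (fun=> 0) => i j; rewrite mxE big_ord0 mul0r.
by exists (B^~ ord0), (C ord0) => i j; rewrite mxE big_ord1.
Qed.

(** Makes each measurement an explicit linear form in the entries of [f], as [lra] requires. *)
Lemma inner_mx_of_rows4 (R : realType) rows (f : nat -> nat -> R) :
  let row i :=
    foldr (fun j s => ((nth [::] rows i)`_j)%:~R * f i j + s) 0 (iota 0 4) in
  inner_mx (mx_of_rows R 4 rows) (\matrix_(i < 4, j < 4) f i j) =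
  foldr (fun i s => row i + s) 0 (iota 0 4).
Proof.
rewrite /inner_mx /mxtrace /= !big_ord_recl big_ord0.
by rewrite !mxE !big_ord_recl !big_ord0 !mxE /=; ring.
Qed.

(** On the kernel, [coordinates] inverts [pencil]; hence each entry of the difference of the two
    sides is a linear combination of the eleven measurements, which [lra] finds. *)
Lemma measure_kernel (R : realType) (f : nat -> nat -> R) :
  measure_map (calA R) (\matrix_(i < 4, j < 4) f i j) = 0 ->
  forall i j, (i < 4)%N -> (j < 4)%N ->
  f i j = pencil R (coordinates R f) i j.
Proof.
move=> /rowP meas0.
have eqs k : (k < 11)%N ->
    inner_mx (nth 0 (calA R) k) (\matrix_(i < 4, j < 4) f i j) = 0.
  by move=> lt_k; have := meas0 (Ordinal lt_k); rewrite !mxE (tnth_nth 0).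
move: (eqs 0%N isT) (eqs 1%N isT) (eqs 2%N isT) (eqs 3%N isT) (eqs 4%N isT)
  (eqs 5%N isT) (eqs 6%N isT) (eqs 7%N isT) (eqs 8%N isT) (eqs 9%N isT)
  (eqs 10%N isT).
rewrite /= !inner_mx_of_rows4 /= => E0 E1 E2 E3 E4 E5 E6 E7 E8 E9 E10.
rewrite /pencil /coordinates /=.
by case=> [|[|[|[|//]]]] [|[|[|[|//]]]] _ _ /=; rewrite /zr; lra.
Qed.

Lemma measure_mapB (R : realType) (n m : nat) (A : m.-tuple 'M[R]_n) :
  {morph measure_map A : X Y / X - Y}.
Proof.
by move=> X Y; apply/rowP => i; rewrite !mxE /inner_mx mulmxBr raddfB.
Qed.

Theorem theorem3p2 (R : realType) :
  {in rank_le1 R 4 &, injective (measure_map (calA R))}.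
Proof.
move=> X Y /rank_le1_outer[a [b XE]] /rank_le1_outer[c [d YE]] eqXY.
(* [inord] sends indices beyond 3 to 0, so this formula holds for all naturals, as [minor_rank2]
   asks; [f] agrees with the pencil only below 4. *)
pose f (i j : nat) := a (inord i) * b (inord j) - c (inord i) * d (inord j).
have XYE : X - Y = \matrix_(i < 4, j < 4) f i j.
  by apply/matrixP => i j; rewrite !mxE XE YE /f !inord_val.
have fE i j : (i < 4)%N -> (j < 4)%N -> f i j = pencil R (coordinates R f) i j.
  by apply: measure_kernel; rewrite -XYE measure_mapB eqXY subrr.
have minors0 i j : (i < 4)%N -> (j < 4)%N ->
    minor R (pencil R (coordinates R f)) i j = 0.
  move=> lti ltj; rewrite -[RHS](minor_rank2 R (a \o inord) (b \o inord)
    (c \o inord) (d \o inord) f i j) //.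
  (* The minor reads only entries with indices below 4; the case split checks these bounds on
     [bump]. *)
  rewrite /minor /det3 !fE //;
    by move: i j lti ltj => [|[|[|[|]]]] [|[|[|[|]]]].
apply/eqP; rewrite -subr_eq0; apply/eqP/matrixP => i j.
rewrite XYE !mxE fE // (eq0_of_minors_eq0 R (coordinates R f)) //.
by rewrite /pencil /= !mulr0 !addr0.
Qed.
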